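(* Let $\mathbf{X}=\{\mathbb{X}_t\}_{t\in\mathbb{R}}$ be a filtration of topological spaces and let $\boldsymbol{\sigma}$ be a family of representative cocycles for the barcodes of $\mathbf{X}$. Then the persistent cup-length function $\mathbf{cup}(\mathbf{X})$ can be retrieved from the persistent cup-length diagram $\mathbf{dgm}_{\boldsymbol{\sigma}}^{\smile}(\mathbf{X})$: for any $\langle a,b\rangle\in\mathbf{Int}$, $$\mathbf{cup}(\mathbf{X})(\langle a,b\rangle)=\max_{\langle c,d\rangle\supseteq\langle a,b\rangle}\mathbf{dgm}_{\boldsymbol{\sigma}}^{\smile}(\mathbf{X})(\langle c,d\rangle),$$ where the maximum is over all $\langle c,d\rangle\in\mathbf{Int}$ containing $\langle a,b\rangle$.
   Context: Fix a field $K$; $\mathbf{H}^*$ denotes cohomology with coefficients in $K$, a graded ring under the cup product $\smile$. A filtration is a family of spaces $\{\mathbb{X}_t\}_{t\in\mathbb{R}}$ with $\mathbb{X}_t\subset\mathbb{X}_s$ for $t\le s$. A real number $t$ is a critical value if there is no neighbourhood of $t$ on which all the maps $\mathbf{H}^*(\mathbb{X}_{s'})\to\mathbf{H}^*(\mathbb{X}_{s})$, $s\le s'$, are isomorphisms. Standing assumptions: $\mathbf{X}$ has finitely many critical values, and $\mathbf{H}^*(\mathbb{X}_t)$ is finite-dimensional for every $t$. Intervals. Fix one interval type $\omega\in\{$open-open, open-closed, closed-open, closed-closed$\}$. $\mathbf{Int}$ is the set of non-empty intervals of $\mathbb{R}$ of type $\omega$, written $\langle a,b\rangle$; infinite endpoints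 are allowed (an interval is open at an infinite end). $\mathcal{B}_p(\mathbf{X})$ is the degree-$p$ barcode: the multiset of intervals in the interval decomposition of the persistence module $t\mapsto\mathbf{H}^p(\mathbb{X}_t)$. Put $\mathcal{B}(\mathbf{X})=\sqcup_{p\ge0}\mathcal{B}_p(\mathbf{X})$ and $\mathcal{B}_{\ge1}(\mathbf{X})=\sqcup_{p\ge1}\mathcal{B}_p(\mathbf{X})$. All bars are assumed to be of the fixed type $\omega$. Representative cocycles. For $I=\langle b,d\rangle\in\mathcal{B}_p(\mathbf{X})$, let $\sigma_I$ be a $p$-cocycle of $\mathbb{X}_d$ if $I$ is closed at $d$, and a $p$-cocycle of $\mathbb{X}_{d-\delta}$ for sufficiently small $\delta>0$ otherwise (of $\mathbb{X}_s$ for sufficiently large $s$ if $d=\infty$). Let $[\sigma_I]_t\in\mathbf{H}^p(\mathbb{X}_t)$ be the class of the restriction of $\sigma_I$ to $\mathbb{X}_t$ for $t$ to the left of the right end of $I$ (including $t=d$ if $I$ is closed at $d$; for $t$ between $d-\delta$ and $d$, or beyond $s$ when $d=\infty$, use the isomorphism $\mathbf{H}^p(\mathbb{X}_t)\cong\mathbf{H}^p(\mathbb{X}_{d-\delta})$, respectively $\mathbf{H}^p(\mathbb{X}_t)\cong\mathbf{H}^p(\mathbb{X}_{s})$), and $[\sigma_I]_t=0$ for $t$ past the right end of $I$. A family $\{\sigma_I\}_{I\in\mathcal{B}_p(\mathbf{X})}$ is a family of representative $p$-cocycles if for every $t\in\mathbb{R}$ the set $\{[\sigma_I]_t : t\in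 I\in\mathcal{B}_p(\mathbf{X})\}$ (indexed by the bars containing $t$) is a linear basis of $\mathbf{H}^p(\mathbb{X}_t)$. A family of representative cocycles $\boldsymbol{\sigma}$ is a union over all $p$ of families of representative $p$-cocycles. Persistent cup-length function. The length $\mathbf{len}(R)$ of a graded ring $R=\bigoplus_{p\ge0}R_p$ is the largest $\ell\ge0$ such that there are homogeneous elements $\eta_1,\dots,\eta_\ell$ of positive degree with $\eta_1\cdots\eta_\ell\ne0$ ($0$ if there are no non-zero elements of positive degree). For $\langle a,b\rangle\in\mathbf{Int}$, $\mathbf{cup}(\mathbf{X})(\langle a,b\rangle)$ is the length of the image ring $\mathbf{Im}(\mathbf{H}^*(\mathbb{X}_{b'})\to\mathbf{H}^*(\mathbb{X}_{a'}))$, where $a'=a$ (resp. $b'=b$) if the interval is closed at that end, and $a'=a+\delta$ (resp. $b'=b-\delta$) for sufficiently small $\delta>0$ if it is open there (for infinite ends: $b'$ sufficiently large, $a'$ sufficiently small). Persistent cup-length diagram. For $I_1,\dots,I_\ell\in\mathcal{B}(\mathbf{X})$, define $I_1*_{\boldsymbol{\sigma}}\cdots*_{\boldsymbol{\sigma}}I_\ell:=\{t\in\mathbb{R}: [\sigma_{I_1}]_t\smile\cdots\smile[\sigma_{I_\ell}]_t\neq0\}$. Then for $I\in\mathbf{Int}$, $$\mathbf{dgm}_{\boldsymbol{\sigma}}^{\smile}(\mathbf{X})(I):=\max\{\ell\ge1 : I=I_1*_{\boldsymbol{\sigma}}\cdots*_{\boldsymbol{\sigma}}I_\ell,\ \text{each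 } I_i\in\mathcal{B}_{\ge1}(\mathbf{X})\},$$ with $\max\emptyset=0$. *)

(* Defs.v *)
From HB Require Import structures.
From mathcomp Require Import all_boot all_order all_algebra.
From mathcomp Require Import generic_quotient ring_quotient.
From mathcomp Require Import zify.
From mathcomp Require Import all_classical all_reals all_analysis.

Set Implicit Arguments.
Unset Strict Implicit.
Unset Printing Implicit Defensive.

Import Order.TTheory GRing.Theory Num.Theory.
Import numFieldNormedType.Exports.

Local Open Scope classical_set_scope.
Local Open Scope ring_scope.

Definition simplex (R : realType) (n : nat) : set 'rV[R]_n.+1 :=
  [set x | (forall i, 0 <= x ord0 i) /\ \sum_i x ord0 i = 1].
Arguments simplex : clear implicits.

Section SimplexMap.
Context {R : realType} {m n : nat}.
Implicit Types (f : 'I_m.+1 -> 'I_n.+1).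

Definition vertex_mx f (x : 'rV[R]_m.+1) : 'rV[R]_n.+1 :=
  \row_j \sum_(i | f i == j) x ord0 i.

Lemma vertex_mx_simplex f x : simplex R m x -> simplex R n (vertex_mx f x).
Proof.
move=> [x0 x1]; split=> [j|]; first by rewrite mxE sumr_ge0.
under eq_bigr do rewrite mxE.
by rewrite -x1 [RHS](partition_big f xpredT).
Qed.

(* The affine map of standard simplices that acts as f on the vertices. *)
Definition simplex_map f (x : simplex R m) : simplex R n :=
  exist _ (vertex_mx f (val x))
    (mem_set (vertex_mx_simplex f (set_mem (valP x)))).

Lemma vertex_mx_continuous f : continuous (vertex_mx f).
Proof.
move=> x A [P PA sPA].
have nU j : nbhs x [set y : 'rV[R]_m.+1 | P ord0 j (vertex_mx f y ord0 j)].
  have cf : {for x, continuous (fun y : 'rV[R]_m.+1 => vertex_mx f y ord0 j)}.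
    rewrite (_ : (fun y => _) =
      (fun y : 'rV[R]_m.+1 => \sum_(i | f i == j) y ord0 i)).
      move: x {PA}; apply: continuous_big => [|i _]; first exact: add_continuous.
      exact: coord_continuous.
    by apply/funext => y; rewrite mxE.
  exact/cf/PA.
have : nbhs x (fun y => forall j, P ord0 j (vertex_mx f y ord0 j)).
  exact: (@filter_forall _ _ _ (nbhs x) _ nU).
by apply: filterS => y Uy; apply: sPA => i j; rewrite ord1; exact: Uy.
Qed.

Lemma simplex_map_continuous f : continuous (simplex_map f).
Proof.
apply: continuous_comp_initial => x.
apply: (@continuous_comp _ _ _ set_val (vertex_mx f)).
  exact: initial_continuous.
exact: vertex_mx_continuous.
Qed.

End SimplexMap.

Definition sing (R : realType) (Y : topologicalType) (n : nat) :=
  continuousType (simplex R n) Y.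

Definition face {R : realType} {Y : topologicalType} {m n : nat}
    (f : 'I_m.+1 -> 'I_n.+1) (s : sing R Y n) : sing R Y m :=
  s \o mkcts (@simplex_map_continuous R m n f).

Definition push {R : realType} {Y Z : topologicalType}
    (g : continuousType Y Z) {n : nat} (s : sing R Y n) : sing R Z n :=
  g \o s.

Lemma face_comp (R : realType) (Y : topologicalType) (l m n : nat)
    (f : 'I_m.+1 -> 'I_n.+1) (g : 'I_l.+1 -> 'I_m.+1) (s : sing R Y n) :
  face g (face f s) = face (f \o g) s.
Proof.
apply/continuousEP => x /=; congr (s _); apply/val_inj/rowP => k /=.
rewrite !mxE; under eq_bigr do rewrite mxE.
rewrite (exchange_big_dep (fun i => f (g i) == k)) /=;
  last by move=> j i /eqP <- /eqP ->.
apply: eq_bigr => i /eqP fgk; rewrite (big_pred1 (g i)) // => j.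
rewrite inE andbC [RHS]eq_sym; case: (g i =P j) => //= <-; exact/eqP.
Qed.

Lemma face_push (R : realType) (Y Z : topologicalType) (g : continuousType Y Z)
    (m n : nat) (f : 'I_m.+1 -> 'I_n.+1) (s : sing R Y n) :
  face f (push g s) = push g (face f s).
Proof. exact/continuousEP. Qed.

Section Cohomology.
Context (R : realType) (K : fieldType) (Y : topologicalType).

Definition cochain (p : nat) := sing R Y p -> K^o.

Definition delta (p : nat) (phi : cochain p) : cochain p.+1 :=
  fun s => \sum_(i < p.+2) (-1) ^+ i * phi (face (lift i) s).

Definition cup_cochain (p q : nat) (phi : cochain p) (psi : cochain q) :
    cochain (p + q) :=
  fun s => phi (face (fun i : 'I_p.+1 => inord i) s) *
           psi (face (fun j : 'I_q.+1 => inord (p + j)) s).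

Definition one_cochain : cochain 0 := fun=> 1.

Lemma deltaD p (phi psi : cochain p) a :
  delta (a *: phi + psi) = a *: delta phi + delta psi.
Proof.
apply/funext => s; rewrite /delta /= !fctE scaler_sumr -big_split.
by apply: eq_bigr => i _ /=; rewrite /GRing.scale /= mulrDr mulrCA.
Qed.

Definition is_cocycle (p : nat) : {pred cochain p} :=
  fun phi => delta phi == 0.

Lemma is_cocycle_submod p : submod_closed (is_cocycle (p := p)).
Proof.
split; rewrite ?unfold_in.
  apply/eqP/funext => s; rewrite /delta big1 // => i _; exact: mulr0.
move=> a u v; rewrite !unfold_in /is_cocycle deltaD => /eqP -> /eqP ->.
by rewrite scaler0 addr0.
Qed.

HB.instance Definition _ p :=
  GRing.isSubmodClosed.Build K (cochain p) (is_cocycle (p := p))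
    (is_cocycle_submod p).

Record cocycle (p : nat) := Cocycle {
  cocycle_val :> cochain p;
  _ : cocycle_val \in is_cocycle (p := p)
}.

HB.instance Definition _ p := [isSub for @cocycle_val p].
HB.instance Definition _ p := [Choice of cocycle p by <:].
HB.instance Definition _ p :=
  [SubChoice_isSubLmodule of cocycle p by <:].

Definition is_coboundary (p : nat) : {pred cocycle p} :=
  match p with
  | 0 => fun phi => phi == 0
  | p'.+1 => fun phi => `[< exists psi : cochain p', val phi = delta psi >]
  end.

Lemma is_coboundary_submod p : submod_closed (is_coboundary (p := p)).
Proof.
case: p => [|p]; split; rewrite ?unfold_in //=.
- by move=> a u v; rewrite !unfold_in /= => /eqP -> /eqP ->; rewrite scaler0 addr0.
- apply/asboolP; exists 0; apply/esym/funext => s.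
  by rewrite /delta big1 // => i _; exact: mulr0.
- move=> a u v; rewrite !unfold_in /= => /asboolP[x ux] /asboolP[y vy].
  by apply/asboolP; exists (a *: x + y); rewrite deltaD /= -ux -vy.
Qed.

HB.instance Definition _ p :=
  GRing.isZmodClosed.Build (cocycle p) (is_coboundary (p := p))
    (GRing.submod_closedB (is_coboundary_submod p)).

Lemma is_coboundaryZ p a (z : cocycle p) :
  z \in is_coboundary (p := p) -> a *: z \in is_coboundary (p := p).
Proof.
have [z0 lin] := is_coboundary_submod p.
by move=> zB; rewrite -[_ *: _]addr0; exact: lin.
Qed.

Definition coh (p : nat) :=
  @Quotient.quot (cocycle p) (is_coboundary (p := p)).

HB.instance Definition _ p := GRing.Zmodule.on (coh p).
HB.instance Definition _ p := EqQuotient.on (coh p).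

Definition coh_class (p : nat) (z : cocycle p) : coh p := \pi_(coh p)%qT z.

Lemma coh_classP p (z w : cocycle p) :
  reflect (coh_class z = coh_class w) (z - w \in is_coboundary (p := p)).
Proof. by rewrite Quotient.idealrBE; exact: eqP. Qed.

Lemma coh_reprK p (x : coh p) : coh_class (repr x) = x.
Proof. exact: reprK. Qed.

Definition coh_scale (p : nat) (a : K) (x : coh p) : coh p :=
  coh_class (a *: repr x).

Lemma coh_scale_pi p a (z : cocycle p) :
  coh_scale a (coh_class z) = coh_class (a *: z).
Proof.
apply/coh_classP; rewrite -scalerBr; apply: is_coboundaryZ.
by apply/coh_classP; rewrite coh_reprK.
Qed.

Lemma coh_classD p (z w : cocycle p) :
  coh_class (z + w) = coh_class z + coh_class w.
Proof. exact: Quotient.pi_add. Qed.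

Fact coh_scaleA p a b (x : coh p) :
  coh_scale a (coh_scale b x) = coh_scale (a * b) x.
Proof. by rewrite -[x]coh_reprK !coh_scale_pi scalerA. Qed.

Fact coh_scale1 p : left_id 1 (@coh_scale p).
Proof. by move=> x; rewrite -[x]coh_reprK coh_scale_pi scale1r. Qed.

Fact coh_scaleDr p : right_distributive (@coh_scale p) +%R.
Proof.
move=> a x y; rewrite -[x]coh_reprK -[y]coh_reprK -coh_classD.
by rewrite !coh_scale_pi scalerDr coh_classD.
Qed.

Fact coh_scaleDl p (x : coh p) :
  {morph (@coh_scale p)^~ x : a b / a + b}.
Proof.
by move=> a b; rewrite -[x]coh_reprK !coh_scale_pi scalerDl coh_classD.
Qed.

HB.instance Definition _ p :=
  GRing.Zmodule_isLmodule.Build K (coh p)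
    (@coh_scaleA p) (@coh_scale1 p) (@coh_scaleDr p) (@coh_scaleDl p).

(* The graded Leibniz rule, evaluated at a simplex. *)
Lemma delta_cup p q (phi : cochain p) (psi : cochain q)
    (s : sing R Y (p + q).+1) :
  delta (cup_cochain phi psi) s =
    delta phi (face (fun i : 'I_p.+2 => inord i) s) *
      psi (face (fun j : 'I_q.+1 => inord (p.+1 + j)) s)
    + (-1) ^+ p * (phi (face (fun i : 'I_p.+1 => inord i) s) *
      delta psi (face (fun j : 'I_q.+2 => inord (p + j)) s)).
Proof.
pose F (i : nat) := phi (face (fun k : 'I_p.+1 => inord (bump i k)) s).
pose G (i : nat) := psi (face (fun k : 'I_q.+1 => inord (p + bump i k)) s).
have bump_lt i n (k : 'I_n.+1) : (bump i k < n.+2)%N.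
  by have := ltn_ord k; rewrite /bump; lia.
have Fp : phi (face (fun i : 'I_p.+1 => inord i) s) = F p.+1.
  congr (phi (face _ s)); apply/funext => k.
  by rewrite /bump leqNgt ltn_ord.
have G0 : psi (face (fun j : 'I_q.+1 => inord (p.+1 + j)) s) = G 0%N.
  by congr (psi (face _ s)); apply/funext => k; rewrite /bump leq0n addnCA addnA.
have dF : delta phi (face (fun i : 'I_p.+2 => inord i) s)
    = \sum_(i < p.+2) (-1) ^+ i * F i.
  apply: eq_bigr => i _; congr (_ * phi _); rewrite face_comp.
  by congr face; apply/funext => k.
have dG : delta psi (face (fun j : 'I_q.+2 => inord (p + j)) s)
    = \sum_(i < q.+2) (-1) ^+ i * G i.
  apply: eq_bigr => i _; congr (_ * psi _); rewrite face_comp.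
  by congr face; apply/funext => k.
have dC : delta (cup_cochain phi psi) s = \sum_(i < (p + q).+2)
    (if (i < p.+1)%N then (-1) ^+ i * (F i * G 0%N)
     else (-1) ^+ i * (F p.+1 * G (i - p)%N)).
  apply: eq_bigr => i _; rewrite /cup_cochain !face_comp.
  case: ltnP => ip; congr (_ * (phi (face _ s) * psi (face _ s)));
    apply/funext => k; apply/val_inj; move: (ltn_ord k) (ltn_ord i) => ? ?;
    by rewrite /= /bump !inordK; lia.
rewrite dC dF dG Fp G0.
pose H (i : nat) := if (i < p.+1)%N then (-1) ^+ i * (F i * G 0%N)
     else (-1) ^+ i * (F p.+1 * G (i - p)%N).
rewrite -(big_mkord xpredT H) (@big_cat_nat _ _ _ p.+1) //=; last first.
  by rewrite ltnS (leq_trans (leq_addr q p)).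
rewrite [in RHS]big_ord_recr /= mulrDl -[RHS]addrA; congr (_ + _).
  rewrite big_mkord mulr_suml; apply: eq_bigr => i _.
  by rewrite /H ltn_ord /= mulrA.
rewrite [in RHS]big_ord_recl /= expr0 mul1r mulrDr mulrDr !mulrA addrA.
rewrite exprS !mulN1r !mulNr addNr add0r.
rewrite -[X in \sum_(X <= _ < _) _]add0n big_addn.
rewrite (_ : ((p + q).+2 - p.+1)%N = q.+1); last by rewrite subSS -addnS addKn.
rewrite big_mkord mulr_sumr; apply: eq_bigr => i _.
rewrite /H ltnNge leq_addl /= addnS subSn ?leq_addl // addnK /bump leq0n add1n.
rewrite -addSn exprD -!mulrA mulrCA; congr (_ * _).
by rewrite mulrCA.
Qed.

Lemma cup_is_cocycle p q (z : cocycle p) (w : cocycle q) :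
  cup_cochain z w \in is_cocycle (p := p + q).
Proof.
have dz : delta z = 0 by apply/eqP; exact: valP z.
have dw : delta w = 0 by apply/eqP; exact: valP w.
apply/eqP/funext => s; rewrite delta_cup dz dw.
by rewrite mul0r add0r !mulr0.
Qed.

Definition cup_cocycle p q (z : cocycle p) (w : cocycle q) : cocycle (p + q) :=
  Cocycle (cup_is_cocycle z w).

(* By delta_cup the class does not depend on the chosen representatives. *)
Definition cup p q (x : coh p) (y : coh q) : coh (p + q) :=
  coh_class (cup_cocycle (repr x) (repr y)).

Lemma one_is_cocycle : one_cochain \in is_cocycle (p := 0).
Proof.
apply/eqP/funext => s; rewrite /delta !big_ord_recl big_ord0 /=.
by rewrite /one_cochain !mulr1 addr0 expr0 expr1 subrr.
Qed.

Definition coh_one : coh 0 := coh_class (Cocycle one_is_cocycle).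

(* Homogeneous elements of the graded ring, tagged with their degree. *)
Definition hcoh := {p : nat & coh p}.

Definition hcup (x y : hcoh) : hcoh :=
  Tagged coh (cup (tagged x) (tagged y)).

(* Cup products are bracketed to the right and end with the unit; the empty
   product is the unit. *)
Definition hcup_prod (s : seq hcoh) : hcoh := foldr hcup (Tagged coh coh_one) s.

End Cohomology.

Arguments hcup_prod {R K Y} s.
Arguments coh_class {R K Y p} z.

Section Pullback.
Context {R : realType} {K : fieldType} {Y Z : topologicalType}.
Context (g : continuousType Y Z) {p : nat}.

Definition pull_cochain (phi : cochain R K Z p) : cochain R K Y p :=
  fun s => phi (push g s).

Lemma pull_is_cocycle (z : cocycle R K Z p) :
  pull_cochain z \in is_cocycle (p := p).
Proof.
have dz : delta z = 0 by apply/eqP; exact: valP z.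
apply/eqP/funext => s; rewrite -[RHS](congr1 (fun phi => phi (push g s)) dz).
by apply: eq_bigr => i _; rewrite /pull_cochain face_push.
Qed.

Definition pull_cocycle (z : cocycle R K Z p) : cocycle R K Y p :=
  Cocycle (pull_is_cocycle z).

Definition pull (x : coh R K Z p) : coh R K Y p :=
  coh_class (pull_cocycle (repr x)).

End Pullback.

Section Inclusion.
Context {T : topologicalType} {A B : set T} (AB : A `<=` B).

Definition incl (x : A) : B := exist _ (val x) (mem_set (AB (set_mem (valP x)))).

Lemma incl_continuous : continuous incl.
Proof. by apply: continuous_comp_initial; exact: initial_continuous. Qed.

End Inclusion.

Definition is_max (A : set nat) (n : nat) : Prop :=
  A n /\ forall m, A m -> (m <= n)%N.

(* The maximum of A, with value 0 if A is empty (or unbounded). *)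
Definition max_nat (A : set nat) : nat := xget 0%N (is_max A).

(* The length of the graded subring of the cohomology ring of Y whose
   component of degree p is S p. *)
Definition ring_length (R : realType) (K : fieldType) (Y : topologicalType)
    (S : forall p, set (coh R K Y p)) : nat :=
  max_nat [set l | exists eta : l.-tuple (hcoh R K Y),
    (forall i, (0 < tag (tnth eta i))%N /\ S _ (tagged (tnth eta i))) /\
    tagged (hcup_prod eta) != 0].

(* \bigoplus_p V p has a finite spanning family. *)
Definition graded_findim (K : fieldType) (V : nat -> lmodType K) : Prop :=
  exists (n : nat) (b : 'I_n -> forall p, V p),
    (forall i, finite_set [set p | b i p != 0]) /\
    forall x : forall p, V p, finite_set [set p | x p != 0] ->
      exists c : 'I_n -> K, forall p, x p = \sum_i c i *: b i p.

Definition is_basis (K : fieldType) (V : lmodType K) (J : choiceType)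
    (D : set J) (e : J -> V) : Prop :=
  (forall x : V, exists (s : seq J) (c : J -> K),
    [set` s] `<=` D /\ x = \sum_(j <- s) c j *: e j) /\
  (forall (s : seq J) (c : J -> K), uniq s -> [set` s] `<=` D ->
    \sum_(j <- s) c j *: e j = 0 -> forall j, j \in s -> c j = 0).

(* The spaces are subspaces of an ambient space T. This is no restriction: a
   nested family of subspaces indexed by the reals embeds in its colimit. *)
Record filtration (R : realType) (T : topologicalType) := Filtration {
  fspace :> R -> set T;
  fspace_mono : forall t s, t <= s -> fspace t `<=` fspace s
}.

(* For each degree, a multiset of intervals given as an indexed family. *)
Record barcode (R : realType) := Barcode {
  bar_idx : nat -> choiceType;
  bar :> forall p, bar_idx p -> interval R
}.

(* Non-empty intervals whose finite left (resp. right) end is closed iff lc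
   (resp. rc) holds. Beware that BSide true is a closed left end but an open
   right end. *)
Definition Int (R : realType) (lc rc : bool) : set (interval R) :=
  [set I : interval R | [/\ I.1 = -oo%O \/ (exists a, I.1 = BSide lc a),
               I.2 = +oo%O \/ (exists b, I.2 = BSide (~~ rc) b)
             & [set` I] !=set0]].

Arguments Int {R} lc rc I.

Section PersistentCohomology.
Context {R : realType} (K : fieldType) {T : topologicalType}.
Variable X : filtration R T.

Local Notation H t p := (coh R K (fspace X t) p).

Definition restr (t s : R) (ts : t <= s) (p : nat) : H s p -> H t p :=
  pull (mkcts (@incl_continuous _ _ _ (fspace_mono ts))).

Definition critical_values : set R :=
  [set t | ~ exists2 U : set R, nbhs t U &
     forall s s' (ss' : s <= s'), U s -> U s' ->
       forall p, bijective (restr ss' (p := p))].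

(* The direct sum of the interval modules of the bars, which evaluates at t to
   the finitely supported functions on the set of bars containing t. *)
Definition bar_sum (J : Type) (B : J -> interval R) (t : R) : set (J -> K^o) :=
  [set f | finite_set [set j | f j != 0] /\
           forall j, f j != 0 -> t \in B j].

Definition bar_sum_map (J : Type) (B : J -> interval R) (t : R)
    (f : J -> K^o) : J -> K^o :=
  fun j => if t \in B j then f j else 0.

Definition is_interval_decomposition (p : nat) (J : Type)
    (B : J -> interval R) : Prop :=
  (forall j, [set` B j] !=set0) /\
  exists Phi : forall t, {linear H t p -> (J -> K^o)},
    [/\ forall t, injective (Phi t),
        forall t, range (Phi t) = bar_sum B t
      & forall t s (ts : t <= s) (x : H s p),
          Phi t (restr ts x) = bar_sum_map B t (Phi s x)].

Definition is_barcode (B : barcode R) : Prop :=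
  forall p, is_interval_decomposition p (@bar _ B p).

(* The a' that are equal to a closed left end, or sufficiently close to an open
   (possibly infinite) one; similarly on the right. *)
Definition left_germ (I : interval R) : set_system R :=
  match I.1 with
  | BSide true a => globally [set a]
  | BSide false a => a^'+
  | BInfty _ => -oo%R
  end.

Definition right_germ (I : interval R) : set_system R :=
  match I.2 with
  | BSide false b => globally [set b]
  | BSide true b => b^'-
  | BInfty _ => +oo%R
  end.

Definition cup_length (I : interval R) : nat :=
  xget 0%N [set n | \forall a' \near left_germ I & b' \near right_germ I,
    forall ab : a' <= b', ring_length (fun p => range (restr ab (p := p))) = n].

Section Diagram.
Variable B : barcode R.

(* One cocycle for each bar, on the space with parameter cbase. *)
Record bar_cocycles := BarCocycles {
  cbase : forall p, bar_idx B p -> R;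
  ccocycle : forall p (j : bar_idx B p),
    cocycle R K (fspace X (cbase j)) p
}.

(* e is a closed right end d, or d - delta with delta so small that all the
   H^p(X_t) with e <= t < d are identified by restriction, or so large that all
   the H^p(X_t) with t >= e are. *)
Definition is_base (p : nat) (I : interval R) (e : R) : Prop :=
  match I.2 with
  | BSide false d => e = d
  | BSide true d =>
      e < d /\ forall t (et : e <= t), t < d -> bijective (restr et (p := p))
  | BInfty _ => forall t (et : e <= t), bijective (restr et (p := p))
  end.

Variable sigma : bar_cocycles.

(* The interval Interval -oo u, with u the right end of the bar, consists of the
   t that are not past this end. The choice is of a unique element: the
   restriction of c if t <= cbase, its image under the inverse of the
   restriction map otherwise. *)
Definition bar_class (t : R) (p : nat) (j : bar_idx B p) : H t p :=
  let c := coh_class (ccocycle sigma j) in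
  if t \in Interval -oo%O (B p j).2 then
    xget 0 [set x | (forall te : t <= cbase sigma j, x = restr te c) /\
                    (forall et : cbase sigma j <= t, restr et x = c)]
  else 0.

Definition is_representative : Prop :=
  forall p,
    (forall j : bar_idx B p, is_base p (B p j) (cbase sigma j)) /\
    (forall t, is_basis [set j | t \in B p j] (@bar_class t p)).

(* I_1 * ... * I_l for s = [:: I_1; ...; I_l]. *)
Definition bar_support (s : seq {p : nat & bar_idx B p}) : set R :=
  [set t | tagged (hcup_prod
     [seq Tagged (coh R K (fspace X t)) (bar_class t (tagged j)) | j <- s])
     != 0].

Definition cup_diagram (I : interval R) : nat :=
  max_nat [set l | (1 <= l)%N /\
    exists s : l.-tuple {p : nat & bar_idx B p},
      (forall i, (1 <= tag (tnth s i))%N) /\ [set` I] = bar_support s].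

End Diagram.
End PersistentCohomology.

(* Main.v *)
Require Import Defs.
From mathcomp Require Import all_boot all_order all_algebra.
From mathcomp Require Import all_classical all_reals all_analysis.

Set Implicit Arguments.
Unset Strict Implicit.
Unset Printing Implicit Defensive.

Import Order.TTheory GRing.Theory Num.Theory.
Import numFieldNormedType.Exports.

Local Open Scope classical_set_scope.
Local Open Scope ring_scope.

(** A covering family of an interval I is a list of bars of positive degree
whose product of representative classes is non-zero at every point of I. Both
sides of the equality are the largest size of a covering family of I (zero if
there is none).

The cup-length: choose a' and b' in I, near the left and the right end, so that
all the restriction maps between points of I to the left of a', and between
points of I to the right of b', are isomorphisms (left_germ_iso,
right_germ_iso). An element of the image of the cohomology at b' in that at a'
is a linear combination of the classes at a' of the bars that contain b'. So if
a product of l such elements is non-zero, expanding it by multilinearity gives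
l bars, of the same degrees, whose product is non-zero at a'
(cosubspace_hcup_prod). By the choice of a' and b' this product is then
non-zero on the whole of I. Conversely, for a covering family of I, the classes
at a' are the restrictions of the classes at b', and their product is non-zero
(image_length_covering).

The diagram: if the product of a list of bars has support J and J contains I,
then the list covers I; so no value of the diagram at such a J exceeds the
cup-length. Conversely a largest covering family of I has some support, which
contains I, and what is left is that this support is an interval of the given
type (bar_support_Int). A product that is non-zero at t stays non-zero to the
right of t up to the smallest right end of its bars. Hence the support is an
interval with the right kind of right end, and the left end is the question.
Representative classes need not vanish to the left of their bar, so the support
can be larger than the intersection of the bars and its left end need not be an
end of one of these bars. But all bars have the same type. If bars are closed
on the left, restriction from points slightly to the right of a to a is
injective, so the support contains its infimum; if they are open on the left,
restriction from a to points slightly to the left of a is injective, so the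
support does not contain its infimum.

The length of a covering family is bounded because the cohomology of the space
at a point of I vanishes in large degrees (graded_findim_bounded). *)

(** * The cup product in cohomology *)

Section CupProduct.
Context (R : realType) (K : fieldType) (Y : topologicalType).
Local Notation cochain := (cochain R K Y).
Local Notation cocycle := (cocycle R K Y).
Local Notation coh := (coh R K Y).

Lemma cocycle_eq p (z w : cocycle p) : (forall s, val z s = val w s) -> z = w.
Proof. by move=> zw; apply/val_inj/funext. Qed.

Lemma delta_cocycle p (z : cocycle p) : delta z = 0.
Proof. by apply/eqP; exact: valP z. Qed.

Lemma is_coboundaryS p (z : cocycle p.+1) (psi : cochain p) :
  (forall s, val z s = delta psi s) -> z \in is_coboundary (p := p.+1).
Proof. by move=> zd; apply/asboolP; exists psi; apply/funext. Qed.

(** The degrees p + q.+1 and (p + q).+1 are equal but not convertible, so a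
cocycle in one degree can only be compared with a coboundary in the other along
an equality of degrees. *)
Lemma is_coboundary_cast n m (e : n = m.+1) (z : cocycle n) (psi : cochain m) :
  (forall s : sing R Y n, val z s = delta psi (ecast k (sing R Y k) e s)) ->
  z \in is_coboundary (p := n).
Proof.
rewrite -(esymK e); move: (esym e) => {}e; case: n / e z => z /= zd.
exact: is_coboundaryS zd.
Qed.

Lemma face_cast n m k (e : n = m) (g : 'I_k.+1 -> nat) (s : sing R Y n) :
  face (fun j : 'I_k.+1 => inord (g j) : 'I_m.+1) (ecast i (sing R Y i) e s) =
  face (fun j : 'I_k.+1 => inord (g j) : 'I_n.+1) s.
Proof. by case: m / e. Qed.

(** The Leibniz rule: if z is the coboundary of psi and w is a cocycle, the
product of z and w is the coboundary of the product of psi and w. *)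
Lemma cup_coboundary_l p q (z : cocycle p) (w : cocycle q) :
  z \in is_coboundary (p := p) ->
  cup_cocycle z w \in is_coboundary (p := p + q).
Proof.
case: p z => [|p] z.
  move=> /eqP ->; rewrite (_ : cup_cocycle 0 w = 0) ?rpred0//.
  by apply: cocycle_eq => s; exact: mul0r.
move=> /asboolP[psi zE].
apply: (@is_coboundaryS _ _ (cup_cochain psi w)) => s.
by rewrite delta_cup delta_cocycle !mulr0 addr0 /= /cup_cochain -zE.
Qed.

Lemma cup_coboundary_r p q (z : cocycle p) (w : cocycle q) :
  w \in is_coboundary (p := q) ->
  cup_cocycle z w \in is_coboundary (p := p + q).
Proof.
case: q w => [|q] w.
  move=> /eqP ->; rewrite (_ : cup_cocycle z 0 = 0) ?rpred0//.
  by apply: cocycle_eq => s; exact: mulr0.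
move=> /asboolP[psi wE].
(* The sign cancels the one of the Leibniz rule. *)
apply: (@is_coboundary_cast _ _ (addnS p q) _
  (cup_cochain z (((-1) ^+ p : K) *: psi))) => s.
rewrite delta_cup delta_cocycle mul0r add0r.
rewrite -[X in delta X]addr0 deltaD -wE.
rewrite (_ : delta 0 = 0) ?addr0; last first.
  have := deltaD (0 : cochain q) 0 (-1).
  by rewrite scaler0 addr0 scaleN1r addNr.
rewrite /= /cup_cochain !face_cast.
rewrite [X in _ = _ * (_ * X)](_ : _ = (-1) ^+ p *
  val w (face (fun j : 'I_q.+2 => inord (p + j)) s)) //.
by rewrite [RHS]mulrCA [_ * (_ * val w _)]mulrA -expr2 sqrr_sign mul1r.
Qed.

(** Changing a factor by a coboundary changes the product by a coboundary. This
makes the properties of the product of cochains descend to classes. *)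
Lemma cup_class p q (z : cocycle p) (w : cocycle q) :
  cup (coh_class z) (coh_class w) = coh_class (cup_cocycle z w).
Proof.
rewrite /cup; set z' := repr _; set w' := repr _.
have zz : z' - z \in is_coboundary (p := p).
  by apply/coh_classP; rewrite coh_reprK.
have ww : w' - w \in is_coboundary (p := q).
  by apply/coh_classP; rewrite coh_reprK.
transitivity (coh_class (cup_cocycle z w')); apply/coh_classP.
  rewrite (_ : _ - _ = cup_cocycle (z' - z) w'); first exact: cup_coboundary_l.
  by apply: cocycle_eq => s; rewrite /= /cup_cochain -mulrBl.
rewrite (_ : _ - _ = cup_cocycle z (w' - w)); first exact: cup_coboundary_r.
by apply: cocycle_eq => s; rewrite /= /cup_cochain -mulrBr.
Qed.

Lemma cup_linear_l p q a (x x' : coh p) (y : coh q) :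
  cup (a *: x + x') y = a *: cup x y + cup x' y.
Proof.
rewrite -[x]coh_reprK -[x']coh_reprK -[y]coh_reprK.
rewrite [a *: _]coh_scale_pi -coh_classD !cup_class [a *: _]coh_scale_pi.
rewrite -coh_classD; congr coh_class; apply: cocycle_eq => s.
by rewrite /= /cup_cochain mulrDl [X in _ = X + _]mulrA.
Qed.

Lemma cup_linear_r p q a (x : coh p) (y y' : coh q) :
  cup x (a *: y + y') = a *: cup x y + cup x y'.
Proof.
rewrite -[x]coh_reprK -[y]coh_reprK -[y']coh_reprK.
rewrite [a *: _]coh_scale_pi -coh_classD !cup_class [a *: _]coh_scale_pi.
rewrite -coh_classD; congr coh_class; apply: cocycle_eq => s.
by rewrite /= /cup_cochain mulrDr; congr (_ + _); exact: mulrCA.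
Qed.

Lemma cup0 p q (y : coh q) : cup (0 : coh p) y = 0.
Proof.
have := cup_linear_l (-1) (0 : coh p) 0 y.
by rewrite scaler0 addr0 scaleN1r addNr.
Qed.

Lemma cupr0 p q (x : coh p) : cup x (0 : coh q) = 0.
Proof.
have := cup_linear_r (-1) x (0 : coh q) 0.
by rewrite scaler0 addr0 scaleN1r addNr.
Qed.

End CupProduct.

(** * Pullback in cohomology *)

Section PullbackTheory.
Context (R : realType) (K : fieldType) (Y Z : topologicalType).
Context (g : continuousType Y Z).
Local Notation pull := (@pull R K Y Z g).

Lemma pull_class p (z : cocycle R K Z p) :
  pull (coh_class z) = coh_class (pull_cocycle g z).
Proof.
rewrite /Defs.pull; set z' := repr _.
have zz : z' - z \in is_coboundary (p := p).
  by apply/coh_classP; rewrite coh_reprK.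
apply/coh_classP; rewrite (_ : _ - _ = pull_cocycle g (z' - z)); last first.
  exact: cocycle_eq.
clearbody z'; case: p z z' zz => [|p] z z'.
  move=> /eqP ->; rewrite (_ : pull_cocycle g 0 = 0) ?rpred0//.
  exact: cocycle_eq.
move=> /asboolP[psi zE].
apply: (@is_coboundaryS _ _ _ _ _ (pull_cochain g psi)).
move=> s; rewrite [LHS](congr1 (fun phi => phi (push g s)) zE).
by apply: eq_bigr => i _; rewrite /pull_cochain face_push.
Qed.

Lemma pull_linear p a (x y : coh R K Z p) :
  pull (a *: x + y) = a *: pull x + pull y.
Proof.
rewrite -[x]coh_reprK -[y]coh_reprK !pull_class.
rewrite ![a *: _]coh_scale_pi -!coh_classD pull_class.
by congr coh_class; exact: cocycle_eq.
Qed.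

Lemma pull_cup p q (x : coh R K Z p) (y : coh R K Z q) :
  pull (cup x y) = cup (pull x) (pull y).
Proof.
rewrite -[x]coh_reprK -[y]coh_reprK cup_class !pull_class cup_class.
congr coh_class; apply: cocycle_eq => s.
by rewrite /= /pull_cochain /cup_cochain /= !face_push.
Qed.

Lemma pull_one : pull (coh_one R K Z) = coh_one R K Y.
Proof. by rewrite pull_class; congr coh_class; exact: cocycle_eq. Qed.

End PullbackTheory.

Lemma pull_comp (R : realType) (K : fieldType) (W Y Z : topologicalType)
    (f : continuousType W Y) (g : continuousType Y Z)
    (h : continuousType W Z) p (x : coh R K Z p) :
  (forall w, h w = g (f w)) -> pull h x = pull f (pull g x).
Proof.
move=> hgf; rewrite -[x]coh_reprK !pull_class.
congr coh_class; apply: cocycle_eq => c; rewrite /= /pull_cochain.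
suff -> : push h c = push g (push f c) by [].
by apply/continuousEP => z; exact: hgf.
Qed.

Lemma pull_id (R : realType) (K : fieldType) (Y : topologicalType)
    (g : continuousType Y Y) p (x : coh R K Y p) :
  (forall y, g y = y) -> pull g x = x.
Proof.
move=> gid; rewrite -[x]coh_reprK !pull_class.
congr coh_class; apply: cocycle_eq => c; rewrite /= /pull_cochain.
suff -> : push g c = c by [].
by apply/continuousEP => z; exact: gid.
Qed.

(** * Products of homogeneous elements *)

Section HomogeneousElements.
Context (R : realType) (K : fieldType) (Y : topologicalType).
Local Notation coh := (coh R K Y).
Local Notation hcoh := (hcoh R K Y).

Lemma tag_hcup_prod (s : seq hcoh) :
  tag (hcup_prod s) = sumn [seq tag h | h <- s].
Proof. by elim: s => //= h s ->. Qed.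

Lemma hcup_prod_factor_neq0 (s : seq hcoh) :
  tagged (hcup_prod s) != 0 -> {in s, forall h : hcoh, tagged h != 0}.
Proof.
elim: s => //= h s IHs s_neq0 h'; rewrite inE => /predU1P[->|h's].
  by apply: contraNneq s_neq0 => ->; rewrite cup0.
by apply: IHs h's; apply: contraNneq s_neq0 => ->; rewrite cupr0.
Qed.

(** The complement of a graded subspace, which is what non-vanishing of a linear
expression describes. For such a predicate, if a linear combination satisfies
it then so does one of the terms. *)
Definition is_cosubspace (C : set hcoh) : Prop :=
  (forall p, ~ C (Tagged coh (0 : coh p))) /\
  (forall p a (x y : coh p), C (Tagged coh (a *: x + y)) ->
     C (Tagged coh x) \/ C (Tagged coh y)).

Lemma cosubspace_neq0 : is_cosubspace [set h : hcoh | tagged h != 0].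
Proof.
split=> [p /=|p a x y /=]; first by rewrite eqxx.
have [->|x0] := eqVneq x 0; last by left.
by rewrite scaler0 add0r; right.
Qed.

(** This closure property lets the expansion of a product go on from the first
factor to the next ones, after the first has been replaced by x. *)
Lemma cosubspace_cup (C : set hcoh) p (x : coh p) : is_cosubspace C ->
  is_cosubspace [set h | C (hcup (Tagged coh x) h)].
Proof.
move=> [C0 CD]; split=> [q|q a y z]; rewrite /hcup /=.
  by rewrite cupr0; exact: C0.
by rewrite cup_linear_r; exact: CD.
Qed.

Lemma cosubspace_sum (C : set hcoh) p (J : eqType) (s : seq J) (c : J -> K)
    (e : J -> coh p) : is_cosubspace C ->
  C (Tagged coh (\sum_(j <- s) c j *: e j)) ->
  exists2 j, j \in s & C (Tagged coh (e j)).
Proof.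
move=> [C0 CD]; elim: s => [|j s IHs]; first by rewrite big_nil => /C0.
rewrite big_cons => /CD[Cj|/IHs[i is_ Ci]].
  by exists j; rewrite ?mem_head.
by exists i; rewrite // inE is_ orbT.
Qed.

(** The multilinear expansion of a product. Replacing the factors one at a time
by one of the terms of their expansions, while keeping the predicate true,
avoids writing the expanded sum, whose terms lie in a degree that depends on the
list of factors. *)
Lemma cosubspace_hcup_prod (C : set hcoh) (J : nat -> choiceType)
    (D : forall p, set (J p)) (e : forall p, J p -> coh p) (eta : seq hcoh) :
  is_cosubspace C ->
  {in eta, forall h : hcoh, exists (s : seq (J (tag h))) (c : J (tag h) -> K),
     [set` s] `<=` @D (tag h) /\ tagged h = \sum_(j <- s) c j *: e _ j} ->
  C (hcup_prod eta) ->
  exists s : seq {p & J p},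
    [/\ [seq tag j | j <- s] = [seq tag h | h <- eta],
        {in s, forall j : {p & J p}, D _ (tagged j)}
      & C (hcup_prod [seq Tagged coh (e _ (tagged j)) | j <- s])].
Proof.
elim: eta C => [|[p x] eta IHeta] C cC span Ceta; first by exists [::].
have [s [c [sD /= xE]]] := span _ (mem_head _ _).
have [j js Cj] : exists2 j, j \in s &
    C (hcup (Tagged coh (e _ j)) (hcup_prod eta)).
  pose C' := [set h : hcoh | C (hcup h (hcup_prod eta))].
  apply: (@cosubspace_sum C' p _ s c (@e p)); last by rewrite /C' -xE.
  have [C0 CD] := cC; split=> [q|q a y z]; rewrite /C' /hcup /=.
    by rewrite cup0; exact: C0.
  by rewrite cup_linear_l; exact: CD.
have span' : {in eta, forall h : hcoh,
    exists (s : seq (J (tag h))) (c : J (tag h) -> K),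
    [set` s] `<=` @D (tag h) /\ tagged h = \sum_(j <- s) c j *: e _ j}.
  by move=> h heta; apply: span; rewrite inE heta orbT.
have [s' [tag_s' s'D Cs']] := IHeta _ (cosubspace_cup (e _ j) cC) span' Cj.
exists (Tagged J j :: s'); split; [by rewrite /= tag_s'| |exact: Cs'].
by move=> i; rewrite inE => /predU1P[->|/s'D //]; apply: sD.
Qed.

End HomogeneousElements.

Section HomogeneousPullback.
Context (R : realType) (K : fieldType) (Y Z : topologicalType).
Context (g : continuousType Y Z).

Definition hpull (h : hcoh R K Z) : hcoh R K Y :=
  Tagged (coh R K Y) (pull g (tagged h)).

Lemma hpull_prod (s : seq (hcoh R K Z)) :
  hpull (hcup_prod s) = hcup_prod (map hpull s).
Proof.
elim: s => [|h s IHs] /=; first by rewrite /hpull /= pull_one.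
by rewrite -IHs /hpull /hcup /= pull_cup.
Qed.

End HomogeneousPullback.

(** Each element of a finite spanning family has finitely many non-zero
components, so all the elements of the family vanish above some degree. *)
Lemma graded_findim_bounded (K : fieldType) (V : nat -> lmodType K) :
  graded_findim V -> exists N, forall p (x : V p), (N <= p)%N -> x = 0.
Proof.
move=> [n [b [bfin bspan]]].
have [N NP] : exists N, forall i p, (N <= p)%N -> b i p = 0.
  have ub i : exists N, forall p, (N <= p)%N -> b i p = 0.
    have [/= s sE] := (finite_seqP _).1 (bfin i).
    exists (\max_(k <- s) k).+1 => p Np; apply/eqP/negPn/negP => bp.
    have ps : p \in s by have : [set p | b i p != 0] p by []; rewrite sE.
    by move: Np; rewrite ltnNge (@leq_bigmax_seq _ s xpredT id p ps).
  have [N NP] := choice ub.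
  exists (\max_i N i)%N => i p Np; apply: NP; apply: leq_trans Np.
  exact: leq_bigmax.
exists N => p x Np.
(* The spanning property is applied to x, extended by zero to other degrees. *)
have [|c cP] := bspan (mathcomp_extra.dfwith (fun q => 0 : V q) p x).
  apply: (@sub_finite_set _ _ [set p]); last exact: finite_set1.
  move=> q /=; have [pq _|pq] := eqVneq p q; first exact: esym.
  by rewrite dfwithout // eqxx.
have := cP p; rewrite dfwithin => ->.
by rewrite big1 // => i _; rewrite NP // scaler0.
Qed.

(** * Restriction maps and critical values *)

Lemma bij_cancel_r (A B C : Type) (f : A -> B) (g : B -> C) (h : A -> C) :
  h =1 g \o f -> bijective f -> bijective h -> bijective g.
Proof.
move=> hgf [f' fK f'K] h_bij; apply: (@eq_bij _ _ (h \o f')).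
  by apply: bij_comp h_bij _; exists f.
by move=> x /=; rewrite hgf /= f'K.
Qed.

Section Restriction.
Context {R : realType} (K : fieldType) {T : topologicalType}.
Variable X : filtration R T.
Local Notation restr := (@restr R K T X).

Lemma restr_linear t s (ts : t <= s) p a (x y : coh R K (X s) p) :
  restr ts (a *: x + y) = a *: restr ts x + restr ts y.
Proof. exact: pull_linear. Qed.

Lemma restr_comp t s u (ts : t <= s) (su : s <= u) (tu : t <= u) p
    (x : coh R K (X u) p) :
  restr tu x = restr ts (restr su x).
Proof.
by apply: pull_comp => w; exact/val_inj.
Qed.

Lemma restr_refl t (tt : t <= t) p (x : coh R K (X t) p) : restr tt x = x.
Proof.
by apply: pull_id => w; exact/val_inj.
Qed.

Lemma restr0 t s (ts : t <= s) p : restr ts (0 : coh R K (X s) p) = 0.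
Proof.
have := restr_linear ts (-1) (0 : coh R K (X s) p) 0.
by rewrite scaler0 addr0 scaleN1r addNr.
Qed.

Lemma restr_sum t s (ts : t <= s) p (J : eqType) (r : seq J) (c : J -> K)
    (e : J -> coh R K (X s) p) :
  restr ts (\sum_(j <- r) c j *: e j) = \sum_(j <- r) c j *: restr ts (e j).
Proof.
elim: r => [|j r IHr]; first by rewrite !big_nil restr0.
by rewrite !big_cons restr_linear IHr.
Qed.

Definition restr_iso (t s : R) : Prop :=
  forall (ts : t <= s) p, bijective (restr ts (p := p)).

Lemma restr_iso_refl t : restr_iso t t.
Proof. by move=> tt p; exists id => x; rewrite restr_refl. Qed.

Lemma restr_iso_trans t s u : t <= s -> s <= u ->
  restr_iso t s -> restr_iso s u -> restr_iso t u.
Proof.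
move=> ts su its isu tu p.
apply: (eq_bij (bij_comp (its ts p) (isu su p))) => x /=.
exact/esym/restr_comp.
Qed.

Lemma restr_iso_cancel_r t s u : t <= s -> s <= u ->
  restr_iso s u -> restr_iso t u -> restr_iso t s.
Proof.
move=> ts su isu itu ts' p; apply: bij_cancel_r (isu su p) _.
  by move=> x /=; apply: restr_comp; exact: le_trans su.
exact: itu.
Qed.

(** A segment is connected, and the points w of it for which the restriction
maps from w to u are isomorphisms form a non-empty, open and closed subset. It
is open and closed because near a non-critical point these maps differ by
isomorphisms. *)
Lemma restr_iso_noncritical u v : u <= v ->
  (forall c, u <= c <= v -> ~ critical_values K X c) -> restr_iso u v.
Proof.
move=> uv nocrit; pose A : set R := `[u, v]%classic.
pose P : set R := A `&` [set w | restr_iso u w].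
have local w : A w -> \forall w' \near w, A w' -> (P w <-> P w').
  move=> Aw; have := nocrit w; rewrite /critical_values => /(_ _)/contrapT.
  case; first by move: Aw; rewrite /A /= in_itv.
  move=> U nU Uiso; apply: filterS (nU) => w' Uw' Aw'.
  have Uw : U w by exact: nbhs_singleton nU.
  move: (Aw) (Aw'); rewrite /A /= !in_itv /= => /andP[uw _] /andP[uw' _].
  have [ww'|/ltW w'w] := leP w w'.
    have iww' : restr_iso w w' by move=> ? p; exact: Uiso.
    by split=> -[_ iuw]; split=> //; [exact: restr_iso_trans iuw iww'|
      exact: restr_iso_cancel_r iww' iuw].
  have iw'w : restr_iso w' w by move=> ? p; exact: Uiso.
  by split=> -[_ iuw]; split=> //; [exact: restr_iso_cancel_r iw'w iuw|
    exact: restr_iso_trans iuw iw'w].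
have PA : P = A.
  apply: (@segment_connected _ u v P).
  - by exists u; split; [rewrite /A /= in_itv /= lexx|exact: restr_iso_refl].
  - exists [set w | A w -> P w]°; first exact: open_interior.
    apply/seteqP; split=> w; last by case=> Aw /interior_subset; exact.
    move=> Pw; have [Aw _] := Pw; split=> //.
    by apply: filterS (local w Aw) => w' /[apply] -[+ _]; exact.
  - exists (~` [set w | A w -> ~ P w]°).
      exact/open_closedC/open_interior.
    apply/seteqP; split=> w; last first.
      case=> Aw; apply: contra_notP => NPw.
      by apply: filterS (local w Aw) => w' /[apply] -[_ PP] /PP.
    move=> Pw; have [Aw _] := Pw; split=> //.
    by move=> /interior_subset /(_ Aw).
suff : P v by case.
by rewrite PA /A /= in_itv /= uv lexx.
Qed.

End Restriction.

(** * Points near the ends of an interval *)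

Lemma near_finite_forall (U : Type) (V : choiceType) (F : set_system U)
    (C : set V) (P : V -> set U) : Filter F -> finite_set C ->
  (forall c, C c -> \forall x \near F, P c x) ->
  \forall x \near F, forall c, C c -> P c x.
Proof.
move=> FF /finite_seqP[s ->]; elim: s => [|c s IHs] FP.
  by apply: nearW => x c; rewrite /= in_nil.
have FPs : \forall x \near F, forall c', [set` s] c' -> P c' x.
  by apply: IHs => c' /= c's; apply: FP; rewrite /= inE c's orbT.
have FPc := FP c (mem_head _ _).
apply: filterS2 FPc FPs => x Pcx Psx c'.
by rewrite /= inE => /predU1P[->|/Psx].
Qed.

Section Germs.
Context {R : realType}.
Implicit Types (I : interval R) (C : set R).

Lemma in_itvE I x : (x \in I) = (I.1 <= BLeft x)%O && (BRight x <= I.2)%O.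
Proof. by case: I => l r; rewrite itv_boundlr. Qed.

Lemma right_germ_proper I m : m \in I -> ProperFilter (right_germ I).
Proof.
case: I => l [[] b|[]] mI; rewrite /right_germ /=;
  last exact: proper_pinfty_nbhs.
- exact: at_left_proper_filter.
- exact: (@globally_properfilter _ _ b).
- by move: mI; rewrite in_itvE => /andP[_].
Qed.

Lemma left_germ_proper I m : m \in I -> ProperFilter (left_germ I).
Proof.
case: I => [[[] a|[]]] r mI; rewrite /left_germ /=.
- exact: (@globally_properfilter _ _ a).
- exact: at_right_proper_filter.
- exact: proper_ninfty_nbhs.
- by move: mI; rewrite in_itvE => /andP[].
Qed.

(** To be used with C the set of critical values. The alternative t = a is there
for a closed left end: then a is this end, which may itself be critical. *)
Lemma left_germ_near I C m : m \in I -> finite_set C ->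
  \forall a \near left_germ I, [/\ a \in I, a <= m &
    forall t, t \in I -> t <= a -> t = a \/ forall c, t <= c <= a -> ~ C c].
Proof.
move=> mI Cfin; pose F := left_germ I.
have FF : ProperFilter F := left_germ_proper mI.
have [[a I1]|I1] :
    (exists a, I.1 = BSide true a) \/ ~ exists a, I.1 = BSide true a.
  exact: lem.
  have aI : a \in I.
    move: mI; rewrite !in_itvE I1 lexx /= => /andP[am]; apply: le_trans.
    by move: am; rewrite !bnd_simp.
  rewrite /left_germ I1 => x /= ->; split=> //.
    by move: mI; rewrite in_itvE I1 bnd_simp => /andP[].
  move=> t; rewrite in_itvE I1 bnd_simp => /andP[at_ _] ta; left.
  by apply/eqP; rewrite eq_le ta.
have inF : \forall a \near F, a \in I /\ a <= m.
  have nearF : \forall a \near F, (I.1 <= BLeft a)%O /\ a <= m.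
    move: mI I1; rewrite in_itvE /F /left_germ.
    case: I.1 => [[] a|[]] /andP[Im _] NI1.
    - by case: NI1; exists a.
    - have am : a < m by move: Im; rewrite bnd_simp.
      near=> x; split; last by apply/ltW; near: x; exact: nbhs_right_lt.
      by rewrite bnd_simp; near: x; exact: nbhs_right_gt.
    - by apply: filterS (nbhs_ninfty_le (num_real m)) => x xm; split.
    - by [].
  apply: filterS nearF => a [Ia am]; split=> //.
  move: mI; rewrite !in_itvE Ia /= => /andP[_]; apply: le_trans.
  by rewrite bnd_simp.
have nearC : \forall a \near F, forall c, C c -> c \in I -> a < c.
  apply: near_finite_forall => // c _.
  have [cI|] := boolP (c \in I); last first.
    by move=> _; exact: nearW.
  apply: filterS (_ : F [set a | a < c]); first by move=> a ac.
  move: cI I1; rewrite in_itvE /F /left_germ.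
  case: I.1 => [[] a|[]] /andP[Ic _] NI1.
  - by case: NI1; exists a.
  - by apply: nbhs_right_lt; move: Ic; rewrite bnd_simp.
  - exact: nbhs_ninfty_lt (num_real c).
  - by [].
apply: filterS2 inF nearC => a [aI am] aC; split=> // t tI ta; right.
move=> c /andP[tc ca] Cc; have : c \in I.
  move: tI aI; rewrite !in_itvE => /andP[It _] /andP[_ aI].
  by rewrite (le_trans It) ?bnd_simp//= (le_trans _ aI) ?bnd_simp.
by move=> /(aC c Cc); rewrite ltNge ca.
Unshelve. all: by end_near.
Qed.

Lemma right_germ_near I C m : m \in I -> finite_set C ->
  \forall b \near right_germ I, [/\ b \in I, m <= b &
    forall t, t \in I -> b <= t -> t = b \/ forall c, b <= c <= t -> ~ C c].
Proof.
move=> mI Cfin; pose F := right_germ I.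
have FF : ProperFilter F := right_germ_proper mI.
have [[b I2]|I2] :
    (exists b, I.2 = BSide false b) \/ ~ exists b, I.2 = BSide false b.
  exact: lem.
  have bI : b \in I.
    move: mI; rewrite !in_itvE I2 lexx andbT /= => /andP[Im mb].
    by apply: le_trans Im _; move: mb; rewrite !bnd_simp.
  rewrite /right_germ I2 => x /= ->; split=> //.
    by move: mI; rewrite in_itvE I2 bnd_simp => /andP[].
  move=> t; rewrite in_itvE I2 bnd_simp => /andP[_ tb] bt; left.
  by apply/eqP; rewrite eq_le bt andbT.
have inF : \forall b \near F, b \in I /\ m <= b.
  have nearF : \forall b \near F, (BRight b <= I.2)%O /\ m <= b.
    move: mI I2; rewrite in_itvE /F /right_germ.
    case: I.2 => [[] b|[]] /andP[_ Im] NI2.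
    - have mb : m < b by move: Im; rewrite bnd_simp.
      near=> x; split; last by apply/ltW; near: x; exact: nbhs_left_gt.
      by rewrite bnd_simp; near: x; exact: nbhs_left_lt.
    - by case: NI2; exists b.
    - by [].
    - by apply: filterS (nbhs_pinfty_ge (num_real m)) => x xm; split.
  apply: filterS nearF => b [Ib mb]; split=> //.
  move: mI; rewrite !in_itvE Ib andbT => /andP[Im _]; apply: le_trans Im _.
  by rewrite bnd_simp.
have nearC : \forall b \near F, forall c, C c -> c \in I -> c < b.
  apply: near_finite_forall => // c _.
  have [cI|] := boolP (c \in I); last first.
    by move=> _; exact: nearW.
  apply: filterS (_ : F [set b | c < b]); first by move=> b cb.
  move: cI I2; rewrite in_itvE /F /right_germ.
  case: I.2 => [[] b|[]] /andP[_ Ic] NI2.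
  - by apply: nbhs_left_gt; move: Ic; rewrite bnd_simp.
  - by case: NI2; exists b.
  - by [].
  - exact: nbhs_pinfty_gt (num_real c).
apply: filterS2 inF nearC => b [bI mb] bC; split=> // t tI bt; right.
move=> c /andP[bc ct] Cc; have : c \in I.
  move: tI bI; rewrite !in_itvE => /andP[_ tI] /andP[Ib _].
  by rewrite (le_trans Ib) ?bnd_simp//= (le_trans _ tI) ?bnd_simp.
by move=> /(bC c Cc); rewrite ltNge bc.
Unshelve. all: by end_near.
Qed.

End Germs.

Section GermIso.
Context {R : realType} (K : fieldType) {T : topologicalType}.
Variable X : filtration R T.
Hypothesis Xfin : finite_set (critical_values K X).

Lemma left_germ_iso I m : m \in I ->
  \forall a \near left_germ I, [/\ a \in I, a <= m &
    forall t, t \in I -> t <= a -> restr_iso K X t a].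
Proof.
move=> mI.
apply: (@filterS _ _ (left_germ_proper mI)) (left_germ_near mI Xfin).
move=> a [aI am aC].
split=> // t tI ta; have [->|tC] := aC t tI ta; first exact: restr_iso_refl.
exact: restr_iso_noncritical.
Qed.

Lemma right_germ_iso I m : m \in I ->
  \forall b \near right_germ I, [/\ b \in I, m <= b &
    forall t, t \in I -> b <= t -> restr_iso K X b t].
Proof.
move=> mI.
apply: (@filterS _ _ (right_germ_proper mI)) (right_germ_near mI Xfin).
move=> b [bI mb bC].
split=> // t tI bt; have [->|tC] := bC t tI bt; first exact: restr_iso_refl.
exact: restr_iso_noncritical.
Qed.

End GermIso.

(** * Bars and restriction maps *)

Section Bars.
Context {R : realType} (K : fieldType) {T : topologicalType}.
Variables (X : filtration R T) (B : barcode R).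
Hypothesis XB : is_barcode K X B.

(** The restriction map is conjugate to the truncation from the functions on the
bars at s to the functions on the bars at t. The indicator function of a bar
that contains t but not s is not in the image of the truncation, and the one of
a bar that contains s but not t is in its kernel. *)
Lemma restr_iso_same_bars t s : t <= s -> restr_iso K X t s ->
  forall p (j : bar_idx B p), (t \in B p j) = (s \in B p j).
Proof.
move=> ts /(_ ts) iso p j; have [_ [Phi [Phi_inj Phi_range Phi_restr]]] := XB p.
pose dj : bar_idx B p -> K^o := fun i => (i == j)%:R.
have djP u : u \in B p j -> bar_sum (@bar _ B p) u dj.
  move=> uj; split=> [|i].
    apply: (@sub_finite_set _ _ [set j]); last exact: finite_set1.
    by move=> i; rewrite /dj /=; case: (i =P j) => //= _; rewrite eqxx.
  by rewrite /dj; case: (i =P j) => [->//|_]; rewrite eqxx.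
apply/idP/idP => [tj|sj].
  move: (djP t tj); rewrite -Phi_range => -[y _ yE].
  have [g _ gK] := iso p; rewrite -(gK y) Phi_restr in yE.
  have : Phi s (g y) j != 0.
    have := congr1 (fun f => f j) yE; rewrite /bar_sum_map tj /dj eqxx => ->.
    exact: oner_neq0.
  have : bar_sum (@bar _ B p) s (Phi s (g y)).
    by rewrite -Phi_range; exists (g y).
  by case=> _; apply.
apply: contraT => tNj; move: (djP s sj); rewrite -Phi_range => -[x _ xE].
have : x = 0.
  apply: (bij_inj (iso p)); apply: Phi_inj; rewrite !Phi_restr xE linear0.
  apply/funext => i; rewrite /bar_sum_map /dj; case: ifP => // ti.
  by case: (i =P j) => // ij; move: tNj; rewrite -ij ti.
move=> x0; move: xE; rewrite x0 linear0 => /(congr1 (fun f => f j)).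
by rewrite /dj eqxx => /esym/eqP; rewrite oner_eq0.
Qed.

(** No bar of s is lost at t, so the truncation by which restriction acts on
functions on bars changes nothing. *)
Lemma restr_inj t s (ts : t <= s) p :
  (forall j : bar_idx B p, s \in B p j -> t \in B p j) ->
  injective (@restr _ K _ X _ _ ts p).
Proof.
move=> sub x y; have [_ [Phi [Phi_inj Phi_range Phi_restr]]] := XB p.
have keep z : Phi t (restr ts z) = Phi s z.
  rewrite Phi_restr; apply/funext => i; rewrite /bar_sum_map.
  have : bar_sum (@bar _ B p) s (Phi s z) by rewrite -Phi_range; exists z.
  case=> _ /(_ i) supp; case: ifPn => // ti; apply/esym/eqP; apply: contraNT ti.
  by move=> /supp/sub.
by move=> /(congr1 (Phi t)); rewrite !keep => /Phi_inj.
Qed.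

End Bars.

(** * Products of representative classes *)

Section BarProducts.
Context {R : realType} (K : fieldType) {T : topologicalType}.
Variables (X : filtration R T) (B : barcode R) (sigma : bar_cocycles K X B).
Hypothesis sigmaP : is_representative sigma.
Local Notation restr := (@restr R K T X).
Local Notation bars := (seq {p : nat & bar_idx B p}).

Lemma base_bijective t p (j : bar_idx B p) (et : cbase sigma j <= t) :
  t \in Interval -oo%O (B p j).2 -> bijective (restr et (p := p)).
Proof.
have [/(_ j) base _] := sigmaP p; move: et base; set e := cbase sigma j => et.
rewrite in_itvE /is_base /=.
case: (B p j).2 => [[] d|b]; last by move=> base _; exact: base.
  by rewrite bnd_simp => -[_ base] td; exact: base.
rewrite bnd_simp => ed td; have te : t = e by apply/le_anti; rewrite et ed td.
by move: et; rewrite te => et; exact: (@restr_iso_refl _ K _ X e et p).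
Qed.

(** The class of a bar is defined by a choice. There is something to choose
because the base point is so near the right end of the bar that restriction to
it is bijective, from every point between it and that end. *)
Lemma bar_classP t p (j : bar_idx B p) : t \in Interval -oo%O (B p j).2 ->
  (forall te : t <= cbase sigma j,
     bar_class sigma t j = restr te (coh_class (ccocycle sigma j))) /\
  (forall et : cbase sigma j <= t,
     restr et (bar_class sigma t j) = coh_class (ccocycle sigma j)).
Proof.
move=> tj; rewrite /bar_class tj; set c := coh_class _; set e := cbase sigma j.
set P := [set x | _]; suff : P (xget 0 P) by []; apply: xgetPex.
have [te|/ltW et] := leP t e.
  exists (restr te c); split=> [te'|et].
    by rewrite (bool_irrelevance te te').
  by rewrite -(restr_comp et te (lexx e)) restr_refl.
have [g _ gK] := base_bijective et tj; exists (g c); split=> [te|et'].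
  by rewrite -(gK c) -(restr_comp te et (lexx t)) restr_refl gK.
by rewrite (bool_irrelevance et' et) gK.
Qed.

Lemma in_ray_le (u : itv_bound R) t s : t <= s ->
  s \in Interval -oo%O u -> t \in Interval -oo%O u.
Proof.
by move=> ts; rewrite !in_itvE /=; apply: le_trans; rewrite bnd_simp.
Qed.

(** To the right of the base point the class is characterized by its restriction
to the base point, so when both t and s are on that side the equation is checked
there. *)
Lemma bar_class_restr t s (ts : t <= s) p (j : bar_idx B p) :
  s \in Interval -oo%O (B p j).2 ->
  restr ts (bar_class sigma s j) = bar_class sigma t j.
Proof.
move=> sj; have tj := in_ray_le ts sj.
have [s_le s_ge] := bar_classP sj; have [t_le t_ge] := bar_classP tj.
have [te|/ltW et] := leP t (cbase sigma j).
  rewrite t_le; have [se|/ltW es] := leP s (cbase sigma j).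
    by rewrite s_le -restr_comp.
  by rewrite -(s_ge es) -restr_comp.
have es := le_trans et ts; apply: (bij_inj (base_bijective et tj)).
by rewrite -restr_comp s_ge t_ge.
Qed.

Definition bar_prod t (s : bars) : hcoh R K (X t) := hcup_prod
  [seq Tagged (coh R K (X t)) (bar_class sigma t (tagged j)) | j <- s].

Definition not_past t (s : bars) : Prop :=
  forall j, j \in s -> t \in Interval -oo%O (B _ (tagged j)).2.

Definition hrestr t u (tu : t <= u) : hcoh R K (X u) -> hcoh R K (X t) :=
  hpull (mkcts (@incl_continuous _ _ _ (@fspace_mono _ _ X _ _ tu))).

Lemma hrestr_neq0 t u (tu : t <= u) (h : hcoh R K (X u)) :
  tagged (hrestr tu h) != 0 -> tagged h != 0.
Proof.
by apply: contraNneq => h0; rewrite /hrestr /= h0; apply/eqP/restr0.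
Qed.

Lemma hrestr_inj_neq0 t u (tu : t <= u) (h : hcoh R K (X u)) :
  (forall p, injective (restr tu (p := p))) ->
  tagged h != 0 -> tagged (hrestr tu h) != 0.
Proof.
move=> inj; apply: contraNneq => h0; apply/eqP/(inj (tag h)).
by rewrite restr0.
Qed.

Lemma bar_prod_restr t u (tu : t <= u) (s : bars) : not_past u s ->
  hrestr tu (bar_prod u s) = bar_prod t s.
Proof.
move=> us; rewrite /hrestr hpull_prod -map_comp; congr hcup_prod.
apply/eq_in_map => j js /=; rewrite /hpull /=; congr Tagged.
exact: bar_class_restr (us j js).
Qed.

(** The class of a bar is zero past the right end of the bar. *)
Lemma bar_support_not_past t (s : bars) : bar_support sigma s t -> not_past t s.
Proof.
move=> /hcup_prod_factor_neq0 nz j js.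
pose h (i : {p & bar_idx B p}) :=
  Tagged (coh R K (X t)) (bar_class sigma t (tagged i)).
have := nz _ (map_f h js).
by apply: contraNT => tj; rewrite /= /bar_class (negPf tj).
Qed.

Lemma bar_support_up t u (s : bars) : t <= u -> not_past u s ->
  bar_support sigma s t -> bar_support sigma s u.
Proof.
move=> tu us; rewrite /bar_support /= -!/(bar_prod _ s).
by rewrite -(bar_prod_restr tu us); exact: hrestr_neq0.
Qed.

Lemma bar_support_down t u (tu : t <= u) (s : bars) :
  (forall p, injective (restr tu (p := p))) ->
  bar_support sigma s u -> bar_support sigma s t.
Proof.
move=> inj su; have us := bar_support_not_past su; move: su.
rewrite /bar_support /= -!/(bar_prod _ s) -(bar_prod_restr tu us).
exact: hrestr_inj_neq0.
Qed.

End BarProducts.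

(** * The support of a product is an interval *)

Section SupportInterval.
Context {R : realType} (K : fieldType) {T : topologicalType}.
Variables (X : filtration R T) (lc rc : bool) (B : barcode R).
Variable sigma : bar_cocycles K X B.
Hypothesis Xfin : finite_set (critical_values K X).
Hypothesis XB : is_barcode K X B.
Hypothesis BInt : forall p (j : bar_idx B p), Int lc rc (B p j).
Hypothesis sigmaP : is_representative sigma.
Local Notation bars := (seq {p : nat & bar_idx B p}).
Local Notation supp := (bar_support sigma).

(** For t' slightly to the right of a no bar contains t' but not a: such a bar
would be closed at a left end c with a < c <= t', so the restriction map from t'
to the points between a and c would not be an isomorphism. Hence restriction
from t' to a is injective. *)
Lemma bar_support_closed_left (s : bars) a : lc ->
  (forall t, a < t -> exists2 t', supp s t' & a <= t' < t) -> supp s a.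
Proof.
move=> lcT approx.
have a1I : a + 1 \in `]a, +oo[ by rewrite in_itv /= andbT ltrDl.
have [a' [+ _ iso]] :=
  filter_ex (FF := left_germ_proper a1I) (left_germ_iso Xfin a1I).
rewrite in_itv /= andbT => aa'.
have [t' st' /andP[at' t'a']] := approx a' aa'.
have [<-//|aNt'] := eqVneq t' a.
have {}at' : a < t' by rewrite lt_neqAle eq_sym aNt' at'.
apply: (bar_support_down sigmaP (tu := ltW at')) st' => p.
apply: (restr_inj XB) => j; have [+ _ _] := BInt j.
rewrite !in_itvE => -[->/=|[c c_def]].
  by apply: le_trans; rewrite bnd_simp ltW.
rewrite c_def lcT !bnd_simp => /andP[ct' t'r].
have ar : (BRight a <= (B p j).2)%O.
  by apply: le_trans t'r; rewrite bnd_simp ltW.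
rewrite ar andbT leNgt; apply/negP => ac.
have [at_ tc] := midf_lt ac; set t := (a + c) / 2 in at_ tc.
have tI : t \in `]a, +oo[ by rewrite in_itv /= andbT.
have t'I : t' \in `]a, +oo[ by rewrite in_itv /= andbT.
have ta' : t <= a' by apply/ltW/(lt_trans tc)/(le_lt_trans ct').
have := restr_iso_same_bars XB ta' (iso _ tI ta') j.
rewrite -(restr_iso_same_bars XB (ltW t'a') (iso _ t'I (ltW t'a')) j).
by rewrite !in_itvE c_def lcT !bnd_simp ct' t'r leNgt tc.
Qed.

(** For b slightly to the left of a no bar contains a but not b: such a bar
would be open at a left end c with b <= c < a, so the restriction map from the
points between c and a to b would not be an isomorphism. Hence restriction from
a to b is injective. *)
Lemma bar_support_open_left (s : bars) a : ~~ lc -> supp s a ->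
  exists2 b, b < a & supp s b.
Proof.
move=> lcF sa.
have a1I : a - 1 \in `]-oo, a[ by rewrite in_itv /= ltrBlDr ltrDl.
have [b [+ _ iso]] :=
  filter_ex (FF := right_germ_proper a1I) (right_germ_iso Xfin a1I).
rewrite in_itv /= => ba; exists b => //.
apply: (bar_support_down sigmaP (tu := ltW ba)) sa => p.
apply: (restr_inj XB) => j; have [+ _ _] := BInt j.
rewrite !in_itvE => -[->/=|[c c_def]].
  by apply: le_trans; rewrite bnd_simp ltW.
rewrite c_def (negPf lcF) !bnd_simp => /andP[ca ar].
have br : (BRight b <= (B p j).2)%O by apply: le_trans ar; rewrite bnd_simp ltW.
rewrite br andbT ltNge; apply/negP => bc.
have [ct ta] := midf_lt ca; set t := (c + a) / 2 in ct ta.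
have tI : t \in `]-oo, a[ by rewrite in_itv.
have bt : b <= t by apply/ltW/(le_lt_trans bc).
have tr : (BRight t <= (B p j).2)%O by apply: le_trans ar; rewrite bnd_simp ltW.
have := restr_iso_same_bars XB bt (iso _ tI bt) j.
by rewrite !in_itvE c_def (negPf lcF) !bnd_simp ct tr br ltNge bc.
Qed.

Definition common_right_end (s : bars) : itv_bound R :=
  foldr (fun j u => Order.min (B _ (tagged j)).2 u) +oo%O s.

Lemma common_right_endP t (s : bars) :
  not_past t s <-> t \in Interval -oo%O (common_right_end s).
Proof.
rewrite in_itvE /=; elim: s => [|j s IHs] /=.
  by split=> // _ j; rewrite in_nil.
rewrite le_min; split=> [past|/andP[tj /IHs ts] i]; last first.
  by rewrite inE => /predU1P[->|/ts//]; rewrite in_itvE.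
apply/andP; split; first by have := past _ (mem_head _ _); rewrite in_itvE.
by apply/IHs => i si; apply: past; rewrite inE si orbT.
Qed.

Lemma common_right_end_type (s : bars) : common_right_end s = +oo%O \/
  exists b, common_right_end s = BSide (~~ rc) b.
Proof.
elim: s => [|j s IHs] /=; first by left.
by rewrite minEle; case: ifP => // _; have [] := BInt (tagged j).
Qed.

(** The right end is the smallest right end of the bars. The left end is the
infimum of the support, if this is finite, and belongs to it exactly when the
bars are closed on the left. *)
Lemma bar_support_Int (s : bars) : supp s !=set0 ->
  exists2 J, Int lc rc J & [set` J] = supp s.
Proof.
move=> s0; pose u := common_right_end s.
suff [l l_type lE] : exists2 l : itv_bound R,
    l = -oo%O \/ (exists a, l = BSide lc a) & [set` Interval l u] = supp s.
  exists (Interval l u) => //.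
  by split; [exact: l_type|exact: common_right_end_type|rewrite lE].
have up t t' : supp s t' -> t' <= t -> (BRight t <= u)%O -> supp s t.
  move=> st' t't tu; apply: (bar_support_up sigmaP t't) st'.
  by apply/common_right_endP; rewrite in_itvE.
have right_u t : supp s t -> (BRight t <= u)%O.
  by move=> /bar_support_not_past/common_right_endP; rewrite in_itvE.
have [lb|Nlb] := pselect (has_lbound (supp s)); last first.
  exists -oo%O; first by left.
  apply/seteqP; split=> t; rewrite /= in_itvE /=; last exact: right_u.
  move=> tu; apply: contrapT => Nst; apply: Nlb; exists t => t' st'.
  by rewrite leNgt; apply/negP => /ltW t't; exact/Nst/(up _ _ st').
pose a := inf (supp s).
have approx t : a < t -> exists2 t', supp s t' & a <= t' < t.
  move=> /(inf_lt s0)[t' st' t't]; exists t' => //.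
  by rewrite t't andbT; exact: ge_inf.
exists (BSide lc a); first by right; exists a.
apply/seteqP; split=> t; rewrite /= in_itvE /=; last first.
  move=> st; rewrite right_u// andbT; have := ge_inf lb st; rewrite -/a => at_.
  have [lcT|lcF] := boolP lc; rewrite bnd_simp//.
  rewrite lt_neqAle at_ andbT; apply/eqP => ta; move: st; rewrite -ta => sa.
  have [b ba sb] := bar_support_open_left lcF sa.
  by have := ge_inf lb sb; rewrite leNgt ba.
move=> /andP[at_ tu].
have [/approx[t' st' /andP[_ /ltW t't]]|ta] := ltP a t.
  exact: up st' t't tu.
have [lcT|lcF] := boolP lc; last first.
  by move: at_; rewrite (negPf lcF) bnd_simp ltNge ta.
have -> : t = a by apply/le_anti; rewrite ta; move: at_; rewrite lcT bnd_simp.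
exact: bar_support_closed_left.
Qed.

End SupportInterval.

(** * Cup-length and covering families *)

Lemma max_natP (A : set nat) (N n0 : nat) :
  A n0 -> (forall n, A n -> (n <= N)%N) -> is_max A (max_nat A).
Proof.
move=> An0 AN; rewrite /max_nat; apply: xgetPex.
have ex : exists n, `[< A n >] by exists n0; exact/asboolP.
have ub n : `[< A n >] -> (n <= N)%N by move/asboolP/AN.
case: (ex_maxnP ex ub) => n /asboolP An nP.
by exists n; split=> // m Am; apply: nP; exact/asboolP.
Qed.

(** The value of max_nat for a bounded set of lengths. Whether the set contains
0 does not affect it: this is why the sets of lengths that occur below need only
agree on positive numbers, and why the empty product, which is non-zero as soon
as the cohomology is, does no harm. *)
Definition positive_max (A : set nat) (n : nat) : Prop :=
  (forall m, A m -> (m <= n)%N) /\ ((0 < n)%N -> A n).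

Lemma max_nat_positive (A : set nat) N :
  (forall m, A m -> (m <= N)%N) -> positive_max A (max_nat A).
Proof.
move=> AN; have [[n0 An0]|A0] := pselect (A !=set0).
  by have [] := max_natP An0 AN.
rewrite /max_nat xgetPN => [|n [An _]]; last by apply: A0; exists n.
by split=> // m Am; case: A0; exists m.
Qed.

Lemma positive_max_unique (A A' : set nat) n n' :
  (forall m, (0 < m)%N -> A m <-> A' m) ->
  positive_max A n -> positive_max A' n' -> n = n'.
Proof.
move=> AA' [An An0] [A'n A'n0]; apply/eqP; rewrite eqn_leq; apply/andP; split.
  by case: n {An} An0 => // n /(_ isT) An; apply/A'n/(AA' n.+1 isT).
by case: n' {A'n} A'n0 => // n' /(_ isT) A'n'; apply/An/(AA' n'.+1 isT).
Qed.

Section CupLength.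
Context {R : realType} (K : fieldType) {T : topologicalType}.
Variables (X : filtration R T) (lc rc : bool) (B : barcode R).
Variable sigma : bar_cocycles K X B.
Hypothesis Xfin : finite_set (critical_values K X).
Hypothesis Xdim : forall t, graded_findim (coh R K (X t)).
Hypothesis XB : is_barcode K X B.
Hypothesis BInt : forall p (j : bar_idx B p), Int lc rc (B p j).
Hypothesis sigmaP : is_representative sigma.
Local Notation restr := (@restr R K T X).
Local Notation bars := (seq {p : nat & bar_idx B p}).
Local Notation supp := (bar_support sigma).

Definition covering_length (I : interval R) : set nat :=
  [set l | (0 < l)%N /\ exists s : bars,
    [/\ size s = l, {in s, forall j : {p & bar_idx B p}, (0 < tag j)%N}
      & [set` I] `<=` supp s]].

(** A product of l classes of positive degree has degree at least l. *)
Lemma size_bar_support_bounded t : exists N, forall s : bars,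
  {in s, forall j : {p & bar_idx B p}, (0 < tag j)%N} -> supp s t ->
  (size s <= N)%N.
Proof.
have [N NP] := graded_findim_bounded (Xdim t).
exists N => s s_pos st; rewrite leqNgt; apply/negP => Ns; move/negP: st; apply.
apply/eqP/NP; rewrite tag_hcup_prod -map_comp; apply: leq_trans (ltnW Ns) _.
elim: s s_pos {Ns} => //= j s IHs s_pos; rewrite -add1n.
rewrite leq_add ?s_pos ?mem_head//.
by apply: IHs => i si; apply: s_pos; rewrite inE si orbT.
Qed.

(** Here a and b are points of I so near to its ends that the restriction maps
between a and the points of I to its left are isomorphisms, and likewise for b
and the points of I to its right. *)
Section Window.
Variables (I : interval R) (a b : R) (ab : a <= b).
Hypotheses (aI : a \in I) (bI : b \in I).
Hypothesis isoa : forall t, t \in I -> t <= a -> restr_iso K X t a.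
Hypothesis isob : forall t, t \in I -> b <= t -> restr_iso K X b t.

(** To the left of a the restriction maps are injective. To the right of a the
product remains non-zero as long as no bar has ended, and the bars contain b,
hence, by the isomorphisms, all the points of I to the right of b. *)
Lemma supp_window (s : bars) :
  {in s, forall j : {p & bar_idx B p}, b \in B _ (tagged j)} -> supp s a ->
  [set` I] `<=` supp s.
Proof.
move=> sb sa t /= tI; have [ta|/ltW at_] := leP t a.
  apply: (bar_support_down sigmaP (tu := ta)) sa => p.
  exact/bij_inj/isoa.
apply: (bar_support_up sigmaP at_) sa => j js.
have in_ray u : u \in B _ (tagged j) -> u \in Interval -oo%O (B _ (tagged j)).2.
  by rewrite !in_itvE => /andP[].
have [tb|/ltW bt] := leP t b; first exact/(in_ray_le tb)/in_ray/sb.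
by apply: in_ray; rewrite -(restr_iso_same_bars XB bt (isob tI bt)); exact: sb.
Qed.

Lemma image_length_covering l : (0 < l)%N ->
  (exists eta : l.-tuple (hcoh R K (X a)),
    (forall i, (0 < tag (tnth eta i))%N /\
       range (restr ab (p := tag (tnth eta i))) (tagged (tnth eta i))) /\
    tagged (hcup_prod eta) != 0) <-> covering_length I l.
Proof.
move=> l0; split=> [[eta [etaP eta_neq0]]|[_ [s [sl s_pos Is]]]].
  have etaP' (h : hcoh R K (X a)) : h \in val eta ->
      (0 < tag h)%N /\ range (restr ab (p := tag h)) (tagged h).
    by move=> /tnthP[i ->].
  pose D p := [set j : bar_idx B p | b \in B p j].
  have span : {in val eta, forall h : hcoh R K (X a),
      exists (r : seq (bar_idx B (tag h))) (c : bar_idx B (tag h) -> K),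
      [set` r] `<=` @D (tag h) /\
      tagged h = \sum_(j <- r) c j *: bar_class sigma a j}.
    move=> h /etaP'[_ [x _ <-]]; have [_ /(_ b)[gen _]] := sigmaP (tag h).
    have [r [c [rD ->]]] := gen x; exists r, c; split=> //.
    rewrite restr_sum; apply: eq_big_seq => j jr; congr (_ *: _).
    apply: bar_class_restr => //.
    by have := rD j jr; rewrite /= !in_itvE => /andP[].
  have [s [tag_s sb sa]] :=
    cosubspace_hcup_prod (@cosubspace_neq0 R K (X a)) span eta_neq0.
  split=> //; exists s; split.
  - by rewrite -(size_tuple eta) -(size_map tag s) tag_s size_map.
  - move=> j /(map_f tag); rewrite tag_s => /mapP[h heta ->].
    by have [] := etaP' h heta.
  - exact: supp_window.
have sa : supp s a by exact: Is.
have sb : not_past b s.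
  by apply: (@bar_support_not_past _ _ _ _ _ sigma); exact: Is.
pose eta := map_tuple
  (fun j : {p & bar_idx B p} =>
     Tagged (coh R K (X a)) (bar_class sigma a (tagged j)))
  (Tuple (introT eqP sl)).
exists eta; split=> // i; rewrite tnth_map /=; set j := tnth _ _.
have js : j \in s by exact: mem_tnth.
split; first exact: s_pos.
by exists (bar_class sigma b (tagged j)) => //; exact/bar_class_restr/sb.
Qed.

End Window.

Lemma covering_length_bounded I m : m \in I ->
  exists N, forall l, covering_length I l -> (l <= N)%N.
Proof.
move=> mI; have [N NP] := size_bar_support_bounded m.
by exists N => l [_ [s [<- s_pos Is]]]; apply: NP => //; exact: Is.
Qed.

Lemma cup_length_covering I : [set` I] !=set0 ->
  positive_max (covering_length I) (cup_length K X I).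
Proof.
move=> [m mI]; have [N NP] := covering_length_bounded mI.
have maxP := max_nat_positive NP.
suff -> : cup_length K X I = max_nat (covering_length I) by [].
have FL := left_germ_proper mI; have FR := right_germ_proper mI.
have nearL := left_germ_iso Xfin mI; have nearR := right_germ_iso Xfin mI.
have lenE a b (ab : a <= b) : a \in I -> b \in I ->
    (forall t, t \in I -> t <= a -> restr_iso K X t a) ->
    (forall t, t \in I -> b <= t -> restr_iso K X b t) ->
    ring_length (fun p => range (restr ab (p := p))) =
    max_nat (covering_length I).
  move=> aI bI isoa isob.
  have lenP := image_length_covering ab aI bI isoa isob.
  apply: positive_max_unique maxP; first exact: lenP.
  apply: (@max_nat_positive _ N) => -[//|l] Al.
  by apply: NP; exact/lenP.
pose L := [set a | [/\ a \in I, a <= m &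
  forall t, t \in I -> t <= a -> restr_iso K X t a]].
pose U := [set b | [/\ b \in I, m <= b &
  forall t, t \in I -> b <= t -> restr_iso K X b t]].
apply: xget_unique => [|n [[V W] /= [FV FW] VW]].
  exists (L, U) => [//|[a b] [[/= aI _ isoa] [bI _ isob]] ab]; exact: lenE.
have [a [[aI am isoa] Va]] := filter_ex (filterI nearL FV).
have [b [[bI mb isob] Wb]] := filter_ex (filterI nearR FW).
have ab := le_trans am mb.
by rewrite -(lenE a b ab aI bI isoa isob); apply/esym/(VW (a, b)).
Qed.

(** A list of bars with support J covers every interval that J contains. The
diagram, being the maximum of a bounded set, is also at least the size of every
list that it ranges over. *)
Lemma cup_diagram_max I J : [set` I] !=set0 -> [set` I] `<=` [set` J] ->
  (cup_diagram sigma J <= cup_length K X I)%N /\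
  forall s : bars, s != [::] ->
    {in s, forall j : {p & bar_idx B p}, (0 < tag j)%N} ->
    [set` J] = supp s -> (size s <= cup_diagram sigma J)%N.
Proof.
move=> I0 IJ; have [lenP _] := cup_length_covering I0.
set D := [set l | (1 <= l)%N /\ exists s : l.-tuple {p : nat & bar_idx B p},
  (forall i, (1 <= tag (tnth s i))%N) /\ [set` J] = supp s].
have D_len l : D l -> (l <= cup_length K X I)%N.
  move=> [l0 [s [s_pos Js]]]; apply: lenP; split=> //; exists s; split.
  - exact: size_tuple.
  - by move=> j /tnthP[i ->]; exact: s_pos.
  - by rewrite -Js.
have [D_dgm dgm_D] := max_nat_positive D_len; split.
  by have [->|/dgm_D/D_len] := posnP (cup_diagram sigma J).
move=> s s0 s_pos Js; apply: D_dgm; split; first by case: s s0 {s_pos Js}.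
by exists (in_tuple s); split=> // i; exact/s_pos/mem_tnth.
Qed.

End CupLength.

Theorem theorem1 (R : realType) (K : fieldType) (T : topologicalType)
    (X : filtration R T) (lc rc : bool) (B : barcode R)
    (sigma : bar_cocycles K X B) :
  finite_set (critical_values K X) ->
  (forall t, graded_findim (coh R K (fspace X t))) ->
  is_barcode K X B ->
  (forall p (j : bar_idx B p), Int lc rc (B p j)) ->
  is_representative sigma ->
  forall I : interval R, Int lc rc I ->
    is_max [set cup_diagram sigma J |
             J in [set J | Int lc rc J /\ [set` I] `<=` [set` J]]]
           (cup_length K X I).
Proof.
move=> Xfin Xdim XB BInt sigmaP I IInt; have [_ _ I0] := IInt.
have dgmP J := cup_diagram_max Xfin Xdim XB sigmaP (J := J) I0.
have [_ attained] := cup_length_covering Xfin Xdim XB sigmaP I0.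
split; last by move=> _ [J [_ /dgmP[dgm_le _]] <-].
(* If the cup-length is zero, the diagram vanishes at I itself. *)
have [len0|/attained[len_gt0 [s [s_len s_pos Is]]]] := posnP (cup_length K X I).
  exists I; first by split. 
  apply/eqP; rewrite len0 -leqn0 -len0.
  by have [] := dgmP I (@subset_refl _ _).
have s_neq0 : s != [::] by rewrite -size_eq0 s_len -lt0n.
have [m mI] := I0.
have [J JInt JE] :=
  bar_support_Int Xfin XB BInt sigmaP (ex_intro _ m (Is m mI)).
have IJ : [set` I] `<=` [set` J] by rewrite JE.
exists J; first by split.
have [dgm_le dgm_ge] := dgmP J IJ.
by apply/eqP; rewrite eqn_leq dgm_le -s_len dgm_ge.
Qed.
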